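(* In the moment coordinates $q_k=p^\circ_{k+1}$ ($k=1,2,\dots$), under which $\Lambda^\circ=\mathbb R[q_1,q_2,\dots]$, the operator $A_{z,z'}:\Lambda^\circ\to\Lambda^\circ$ is the differential operator $$A_{z,z'}=\sum_{i,j=1}^\infty(i+1)(j+1)(q_{i+j}-q_iq_j)\frac{\partial^2}{\partial q_i\partial q_j}-zz'\sum_{i=1}^\infty(i+1)q_i\frac{\partial}{\partial q_i}+(z+z')\sum_{i=1}^\infty(i+1)q_{i-1}\frac{\partial}{\partial q_i}+\sum_{i,j=0}^\infty(i+j+3)q_iq_j\frac{\partial}{\partial q_{i+j+2}}-\sum_{i=1}^\infty(i+1)iq_i\frac{\partial}{\partial q_i},$$ where $q_0:=1$.
   Context: $\Lambda=\mathbb R[p_1,p_2,\dots]$ is the algebra of symmetric functions (power sums $p_k$, Schur functions $s_\mu$ indexed by Young diagrams $\mu$), $\Lambda^\circ=\Lambda/(p_1-1)$, $f\mapsto f^\circ$ the quotient map; $p_1^\circ=1$ and $\Lambda^\circ$ is freely generated by $p^\circ_2,p^\circ_3,\dots$. $(z,z')$ is fixed in the principal series ($z\notin\mathbb R$, $z'=\bar z$) or complementary series ($z,z'\in(N,N+1)$, $N\in\mathbb Z$). $\mu_\bullet\nearrow\mu$ means $\mu_\bullet\subset\mu$, $|\mu|=|\mu_\bullet|+1$; $(z)_\theta=\prod_{(i,j)\in\theta}(z+j-i)$ for a skew diagram $\theta$ ($(i,j)$ = row $i$, column $j$). $A_{z,z'}:\Lambda^\circ\to\Lambda^\circ$ is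 the linear operator defined by $A_{z,z'}s^\circ_\mu=-m(m-1+zz')s^\circ_\mu+\sum_{\mu_\bullet\nearrow\mu}(z)_{\mu/\mu_\bullet}(z')_{\mu/\mu_\bullet}s^\circ_{\mu_\bullet}$, $m=|\mu|$ (this is well defined). *)

(* Defs.v *)
From HB Require Import structures.
From mathcomp Require Import all_boot all_order all_algebra.
From mathcomp Require Import mpoly.
From mathcomp Require Import complex.
Unset Printing Implicit Defensive.
Import Order.TTheory GRing.Theory Num.Theory.
Local Open Scope ring_scope.

(*  Lambda_n  = {mpoly R[n]} with 'X_i read as the power sum p_(i+1),         *)
(*              i.e. R[p_1,...,p_n]  (truncation of Lambda = R[p_1,p_2,...]). *)
(*  Lambda°_n = {mpoly R[n]} with 'X_i read as q_(i+1) = p°_(i+2),            *)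
(*              i.e. R[q_1,...,q_n]  (truncation of Lambda° = R[q_1,q_2,..]). *)
Section Defs.
Variable R : rcfType.

(* k-th variable (1-based); 0 for k = 0 or k > n. *)
Definition var1 (n k : nat) : {mpoly R[n]} :=
  match k with
  | 0 => 0
  | k'.+1 => match @insub _ (fun i => i < n)%N 'I_n k' with
             | Some i => 'X_i
             | None => 0
             end
  end.

Definition psum (n k : nat) : {mpoly R[n]} := var1 n k.

Definition qv (n k : nat) : {mpoly R[n]} := if k == 0%N then 1 else var1 n k.

Definition dq (n k : nat) (p : {mpoly R[n]}) : {mpoly R[n]} :=
  match k with
  | 0 => 0
  | k'.+1 => match @insub _ (fun i => i < n)%N 'I_n k' with
             | Some i => p^`M(i)
             | None => 0
             end
  end.

(* complete homogeneous symmetric functions h_0,...,h_k in power sums,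
   via Newton's identity  k h_k = sum_{r=1}^k p_r h_{k-r},  h_0 = 1. *)
Fixpoint hseq (n k : nat) : seq {mpoly R[n]} :=
  match k with
  | 0 => [:: 1]
  | k'.+1 => let s := hseq n k' in
      rcons s ((k'.+1%:R)^-1 *: \sum_(1 <= r < k'.+2) psum n r * nth 0 s (k'.+1 - r))
  end.

Definition hP (n k : nat) : {mpoly R[n]} := nth 0 (hseq n k) k.

Definition hZ (n : nat) (k : int) : {mpoly R[n]} :=
  match k with Posz k => hP n k | Negz _ => 0 end.

(* Schur function s_mu in Lambda_n (Jacobi-Trudi): det[h_{mu_i - i + j}] *)
Definition schurP (n : nat) (mu : seq nat) : {mpoly R[n]} :=
  \det (\matrix_(i < size mu, j < size mu)
          hZ n ((nth 0%N mu i)%:Z - (i : nat)%:Z + (j : nat)%:Z)).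

(* quotient map Lambda_n -> Lambda°_n,  f |-> f°: p_1 |-> 1, p_k |-> q_(k-1). *)
Definition circ (n : nat) (f : {mpoly R[n]}) : {mpoly R[n]} :=
  comp_mpoly (mktuple (fun i : 'I_n => qv n i)) f.

Definition schur0 (n : nat) (mu : seq nat) : {mpoly R[n]} := circ n (schurP n mu).

(* The differential operator of the theorem, truncated to Lambda°_n;
   a = z z', b = z + z'. *)
Definition Dop (n : nat) (a b : R) (p : {mpoly R[n]}) : {mpoly R[n]} :=
    \sum_(1 <= i < n.+1) \sum_(1 <= j < n.+1)
       ((i.+1 * j.+1)%:R *: ((qv n (i + j) - qv n i * qv n j) * dq n i (dq n j p)))
  - a *: \sum_(1 <= i < n.+1) (i.+1%:R *: (qv n i * dq n i p))
  + b *: \sum_(1 <= i < n.+1) (i.+1%:R *: (qv n i.-1 * dq n i p))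
  + \sum_(0 <= i < n.+1) \sum_(0 <= j < n.+1)
       ((i + j + 3)%:R *: (qv n i * qv n j * dq n (i + j + 2) p))
  - \sum_(1 <= i < n.+1) ((i.+1 * i)%:R *: (qv n i * dq n i p)).

End Defs.

Definition is_partition (mu : seq nat) : bool :=
  sorted geq mu && (0%N \notin mu).

Definition corner (mu : seq nat) (r : nat) : bool :=
  (nth 0%N mu r.+1 < nth 0%N mu r)%N.

Definition remove_box (mu : seq nat) (r : nat) : seq nat :=
  [seq x <- set_nth 0%N mu r (nth 0%N mu r).-1 | (0 < x)%N].

(* Content j - i of the removed box (1-based row i = r+1, column j = mu_r). *)
Definition box_content (mu : seq nat) (r : nat) : int :=
  (nth 0%N mu r)%:Z - (r.+1)%:Z.

Definition principal_or_complementary (R : rcfType) (z z' : R[i]) : Prop :=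
  (complex.Im z != 0 /\ complex.Re z' = complex.Re z /\ complex.Im z' = - complex.Im z)
  \/ (exists N : int, complex.Im z = 0 /\ complex.Im z' = 0 /\
        N%:~R < complex.Re z < N%:~R + 1 /\ N%:~R < complex.Re z' < N%:~R + 1).

(* Main.v *)
Require Import Defs.
From HB Require Import structures.
From mathcomp Require Import all_boot all_order all_algebra.
From mathcomp Require Import mpoly.
From mathcomp Require Import complex.
From mathcomp Require Import perm zify ring.
Import Order.TTheory GRing.Theory Num.Theory.
Local Open Scope ring_scope.

(* Write p_1 = 1, p_k = q_(k-1), let h_N be the complete functions and
   S(b, c) = det h_(b_i + c_j), so that s_mu = S(b, c) for b_i = mu_i - i and
   c_j = j.  As k d/dp_k h_N = h_(N-k), the operator D_k = k d/dq_(k-1) lowers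
   by k one column at a time, or, equivalently, one row at a time; the latter
   description gives a meaning to D_1, and D_1 s_mu is the sum of the
   s_(mu minus a box).  Newton's identity N h_N = sum_r p_r h_(N-r) yields
     sum_k p_k D_k S(b, c) = (sum b + sum c) S(b, c),
     sum_k p_k D_(k+1) s_mu = sum_i (b_i - 1) S(b - e_i, c),
     sum_(k,l) (p_(k+l-1) D_k D_l + p_k p_l D_(k+l+1)) s_mu
       = sum_i (b_i - 1)^2 S(b - e_i, c),
   where b_i - 1 is the content of the last box of row i.  The operator of the
   theorem is a combination of these three: since p_1 = 1, the coefficients
   p_(k+l-1) - p_k p_l vanish for k = 1 or l = 1, so its sums may be extended
   to k, l >= 1. *)

(** * Identities for Jacobi-Trudi determinants *)

Lemma sum1_extend (V : nmodType) (F : nat -> V) B B' :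
  (B <= B')%N -> (forall k, (B <= k)%N -> F k = 0) ->
  \sum_(1 <= k < B) F k = \sum_(1 <= k < B') F k.
Proof.
move=> leB F0; rewrite (big_nat_widen 1 B B') // big_mkcond /=.
by apply: eq_bigr => k _; case: ltnP => // /F0.
Qed.

Lemma sum1_rev (V : nmodType) (F : nat -> V) N :
  \sum_(1 <= k < N.+1) F k = \sum_(0 <= x < N) F (N - x)%N.
Proof.
rewrite big_add1 big_nat_rev; apply: eq_big_nat => x xN; congr F; lia.
Qed.

(** The diagonal condition is separate because antisymmetry alone only gives 2 Q(x, x) = 0. *)
Lemma alternating_sum0 (V : zmodType) (Q : nat -> nat -> V) N :
  (forall x y, Q x y = - Q y x) -> (forall x, Q x x = 0) ->
  \sum_(0 <= x < N) \sum_(0 <= y < N) Q x y = 0.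
Proof.
move=> anti diag; elim: N => [|N IH]; first by rewrite big_geq.
rewrite big_nat_recr //= big_nat_recr //= diag addr0.
under eq_bigr do rewrite big_nat_recr //=.
rewrite big_split /= IH add0r -big_split big1 // => x _.
by rewrite /= [Q x N]anti addNr.
Qed.

Lemma sum_ord_gt (V : nmodType) L (j : 'I_L) (x : V) :
  \sum_(i < L | (i < j)%N) x = x *+ j.
Proof. by rewrite (big_ord_narrow (ltnW (ltn_ord j))) sumr_const card_ord. Qed.

(** There are r pairs k, l >= 1 with k + l - 1 = r, and for r < B all of them lie in the summation
    range. *)
Lemma sum_hankel (V : nmodType) (G : nat -> V) B :
  (forall r, (B <= r)%N -> G r = 0) ->
  \sum_(1 <= k < B) \sum_(1 <= l < B) G (k + l - 1)%N
  = \sum_(1 <= r < B) G r *+ r.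
Proof.
move=> GB.
have -> : \sum_(1 <= k < B) \sum_(1 <= l < B) G (k + l - 1)%N
    = \sum_(1 <= k < B) \sum_(1 <= r < B | (k <= r)%N) G r.
  apply: eq_big_nat => k kB.
  rewrite -(sum1_extend _ _ (B - k.-1)); [|lia|]; last first.
    by move=> l lB; apply: GB; lia.
  rewrite -[RHS](big_nat_widenl k 1 B predT) /=; last lia.
  have e : k = (1 + k.-1)%N by lia.
  rewrite {3}e big_addn; apply: eq_big_nat => l lB; congr G; lia.
rewrite (exchange_big_dep_nat predT) /=; last by [].
apply: eq_big_nat => r rB.
transitivity (\sum_(1 <= k < r.+1) G r); last by rewrite sumr_const_nat subn1.
by rewrite [RHS](big_nat_widen 1 r.+1 B) //; lia.
Qed.

Section JacobiTrudi.
Variables (A : comNzRingType) (H : int -> A) (L : nat).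
Implicit Types (b c : 'I_L -> int) (i j : 'I_L).

Definition JTmx b c : 'M[A]_L := \matrix_(i, j) H (b i + c j).
Definition JT b c : A := \det (JTmx b c).

Definition upd c j (x : int) : 'I_L -> int :=
  fun j' => if j' == j then x else c j'.

(** Entries depend only on the sum of a row shift and a column shift, so the same operation serves
    for columns (applied to [c]) and for rows (applied to [b]). *)
Definition lower c j (k : nat) := upd c j (c j - k%:Z).

Lemma eq_JT b b' c c' : b =1 b' -> c =1 c' -> JT b c = JT b' c'.
Proof.
by move=> eb ec; congr (\det _); apply/matrixP=> i j; rewrite !mxE eb ec.
Qed.

Lemma JT_sym b c : JT b c = JT c b.
Proof.
by rewrite /JT -det_tr; congr (\det _); apply/matrixP=> i j; rewrite !mxE addrC.
Qed.

Lemma JT_eqcol b c j j' : j != j' -> c j = c j' -> JT b c = 0.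
Proof.
move=> nj ec; rewrite JT_sym; apply: (determinant_alternate nj) => i.
by rewrite !mxE ec.
Qed.

Lemma JT_swap b c j j' :
  j != j' -> JT b (fun x => c (tperm j j' x)) = - JT b c.
Proof.
move=> nj; rewrite JT_sym [JT b c]JT_sym /JT.
have -> : JTmx (fun x => c (tperm j j' x)) b = row_perm (tperm j j') (JTmx c b).
  by apply/matrixP=> i i'; rewrite !mxE.
by rewrite row_permE det_mulmx det_perm odd_tperm nj expr1 mulN1r.
Qed.

(** The cofactors along column [j] do not involve that column, so they are those of the unmodified
    matrix. *)
Lemma JT_upd b c j x :
  JT b (upd c j x) = \sum_i H (b i + x) * cofactor (JTmx b c) i j.
Proof.
rewrite /JT (expand_det_col _ j); apply: eq_bigr => i _.
rewrite mxE /upd eqxx; congr (_ * (_ * \det _)).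
by apply/matrixP=> i' j'; rewrite !mxE eq_sym (negPf (neq_lift _ _)).
Qed.

Lemma JT_upd_row b c i x :
  JT (upd b i x) c = \sum_j H (x + c j) * cofactor (JTmx b c) i j.
Proof.
rewrite JT_sym JT_upd; apply: eq_bigr => j _; rewrite [x + _]addrC.
suff -> : JTmx c b = (JTmx b c)^T by rewrite cofactor_tr.
by apply/matrixP=> i' j'; rewrite !mxE addrC.
Qed.

(** A common normal form: sums of lowered determinants become combinations of the cofactors of the
    original matrix, to be compared coefficient by coefficient. *)
Lemma sum_lower_col b c (w : 'I_L -> A) k :
  \sum_j w j * JT b (lower c j k)
  = \sum_i \sum_j w j * H (b i + c j - k%:Z) * cofactor (JTmx b c) i j.
Proof.
rewrite exchange_big; apply: eq_bigr => j _.
rewrite JT_upd mulr_sumr; apply: eq_bigr => i _; by rewrite mulrA addrA.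
Qed.

Lemma sum_lower_row b c (w : 'I_L -> A) k :
  \sum_i w i * JT (lower b i k) c
  = \sum_i \sum_j w i * H (b i + c j - k%:Z) * cofactor (JTmx b c) i j.
Proof.
apply: eq_bigr => i _.
rewrite JT_upd_row mulr_sumr; apply: eq_bigr => j _.
by rewrite mulrA addrAC.
Qed.

Lemma lower_row_col b c k :
  \sum_j JT b (lower c j k) = \sum_i JT (lower b i k) c.
Proof.
have E (F : 'I_L -> A) : \sum_i F i = \sum_i 1 * F i.
  by apply: eq_bigr => i _; rewrite mul1r.
by rewrite E sum_lower_col E sum_lower_row.
Qed.

Lemma JT_expand b c (w : 'I_L -> int) :
  \sum_i \sum_j (w i)%:~R * H (b i + c j) * cofactor (JTmx b c) i j
  = (\sum_i w i)%:~R * JT b c.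
Proof.
rewrite rmorph_sum mulr_suml /=; apply: eq_bigr => i _.
rewrite /JT (expand_det_row _ i) mulr_sumr; apply: eq_bigr => j _.
by rewrite mxE -mulrA.
Qed.

Lemma JT_expand_col b c (w : 'I_L -> int) :
  \sum_i \sum_j (w j)%:~R * H (b i + c j) * cofactor (JTmx b c) i j
  = (\sum_j w j)%:~R * JT b c.
Proof.
rewrite rmorph_sum mulr_suml /= exchange_big; apply: eq_bigr => j _.
rewrite /JT (expand_det_col _ j) mulr_sumr; apply: eq_bigr => i _.
by rewrite mxE -mulrA.
Qed.

Definition std : 'I_L -> int := fun j => (j : nat)%:Z.

(** Lowering column j by r turns it into a copy of column j - r. *)
Lemma lower_std_dup b (j : 'I_L) (r : nat) :
  (0 < r)%N -> (r <= j)%N -> JT b (lower std j r) = 0.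
Proof.
move=> r0 rj; have lt : (j - r < L)%N by move: (ltn_ord j); lia.
have nj : j != Ordinal lt by rewrite -val_eqE /=; lia.
apply: (JT_eqcol _ _ _ _ nj).
by rewrite /lower /upd eqxx eq_sym (negPf nj) /std /= ; lia.
Qed.

(** Only column 0 survives lowering by 1, and its weight is zero. Hence a weight in j vanishing at 0
    may be added to the coefficients of H(b_i + j - 1) at no cost. *)
Lemma lower_std_weighted b (w : nat -> A) : w 0%N = 0 ->
  \sum_(j < L) w j * JT b (lower std j 1) = 0.
Proof.
move=> w0; apply: big1 => j _; case: (posnP j) => [-> | j0].
  by rewrite w0 mul0r.
by rewrite lower_std_dup ?mulr0.
Qed.

(* [P r] is the power sum p_r; [P] vanishes from [B] on. *)
Variables (P : nat -> A) (B : nat).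
Hypothesis PB : forall r, (B <= r)%N -> P r = 0.
Hypothesis newton : forall N : int,
  N%:~R * H N = \sum_(1 <= r < B) P r * H (N - r%:Z).

(** Interchanging the sums leaves Newton's identity for each entry, with N = b_i + c_j. *)
Lemma newton_lower b c (w : 'I_L -> A) :
  \sum_(1 <= r < B) P r * \sum_j w j * JT b (lower c j r)
  = \sum_i \sum_j w j * (b i + c j)%:~R * H (b i + c j) * cofactor (JTmx b c) i j.
Proof.
under eq_bigr do rewrite sum_lower_col mulr_sumr.
rewrite exchange_big; apply: eq_bigr => i _ /=.
under eq_bigr do rewrite mulr_sumr.
rewrite exchange_big; apply: eq_bigr => j _ /=.
rewrite -[w j * _ * _]mulrA newton mulr_sumr mulr_suml; apply: eq_bigr => r _.
ring.
Qed.

Lemma newton_lowerS b c (w : 'I_L -> A) :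
  \sum_(1 <= r < B) P r * \sum_j w j * JT b (lower c j r.+1)
  = \sum_i \sum_j w j * (b i + c j - 1)%:~R * H (b i + c j - 1)
      * cofactor (JTmx b c) i j.
Proof.
under eq_bigr do rewrite sum_lower_col mulr_sumr.
rewrite exchange_big; apply: eq_bigr => i _ /=.
under eq_bigr do rewrite mulr_sumr.
rewrite exchange_big; apply: eq_bigr => j _ /=.
rewrite -[w j * _ * _]mulrA newton mulr_sumr mulr_suml; apply: eq_bigr => r _.
have -> : b i + c j - r.+1%:Z = b i + c j - 1 - r%:Z by lia.
ring.
Qed.

(** The factor b_i + c_j from Newton's identity splits: row expansions handle the row part, column
    expansions the column part. *)
Lemma euler b c :
  \sum_(1 <= r < B) P r * \sum_j JT b (lower c j r)
  = (\sum_i b i + \sum_j c j)%:~R * JT b c.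
Proof.
have := newton_lower b c (fun=> 1).
under eq_bigr do under eq_bigr do rewrite mul1r.
move=> ->; rewrite intrD mulrDl -JT_expand -JT_expand_col -big_split.
apply: eq_bigr => i _; rewrite -big_split; apply: eq_bigr => j _ /=.
rewrite intrD; ring.
Qed.

(** Here N = b_i + j - 1 is the sum of b_i - 1 and j, and the part with j vanishes by
    [lower_std_weighted]. *)
Lemma content_sum b :
  \sum_(1 <= r < B) P r * \sum_j JT b (lower std j r.+1)
  = \sum_i (b i - 1)%:~R * JT (lower b i 1) std.
Proof.
have := newton_lowerS b std (fun=> 1).
under eq_bigr do under eq_bigr do rewrite mul1r.
move=> ->; rewrite sum_lower_row.
rewrite -[RHS]addr0 -[X in _ = _ + X](lower_std_weighted b (fun k => k%:R)) //.
rewrite sum_lower_col.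
rewrite -big_split; apply: eq_bigr => i _; rewrite -big_split.
apply: eq_bigr => j _ /=; rewrite -[j%:R]/(j%:Z%:~R) /std.
have -> : b i + j%:Z - 1 = (b i - 1) + j%:Z by lia.
rewrite intrD; ring.
Qed.

Lemma JT_upd2_swap b c j j' u v : j != j' ->
  JT b (upd (upd c j u) j' v) = - JT b (upd (upd c j v) j' u).
Proof.
move=> nj; rewrite -(JT_swap _ _ _ _ nj); apply: eq_JT => // x.
rewrite /upd; case: tpermP => [->|->|/eqP n1 /eqP n2].
- by rewrite !eqxx (negPf nj).
- by rewrite !eqxx (negPf nj).
- by rewrite (negPf n1) (negPf n2).
Qed.

(* With u = j - k and v = j' - l, the weight p_(j+j'-u-v-1) is symmetric and the
   determinant is alternating in (u, v), so the part with u, v < j vanishes; for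
   j < v < j' there is a repeated column, so only v = j is left. *)
Lemma offdiag_sum b j j' : (j < j')%N ->
  \sum_(1 <= k < B) \sum_(1 <= l < B)
     P (k + l - 1) * JT b (lower (lower std j k) j' l)
  = - \sum_(1 <= r < B) P r * JT b (lower std j' r.+1).
Proof.
move=> ltj; have nj : j != j' by rewrite -val_eqE /=; lia.
pose A2 u v := JT b (upd (upd std j u) j' v).
(* The shifts x = u + B and y = v + B keep the indices natural. Extending k to B + j and l to B + j'
   only adds terms where [P] is zero, and makes both ranges start at 0. *)
pose Q x y := P ((B + j) + (B + j') - 1 - x - y)%N
                * A2 (x%:Z - B%:Z) (y%:Z - B%:Z).
have Qanti x y : Q x y = - Q y x.
  rewrite /Q /A2 JT_upd2_swap // mulrN; congr (- (P _ * _)); lia.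
have Qdiag x : Q x x = 0.
  rewrite /Q /A2 (JT_eqcol _ _ _ _ nj) ?mulr0 //.
  by rewrite /upd !eqxx (negPf nj).
have -> : \sum_(1 <= k < B) \sum_(1 <= l < B)
     P (k + l - 1)%N * JT b (lower (lower std j k) j' l)
    = \sum_(0 <= x < B + j) \sum_(0 <= y < B + j') Q x y.
  rewrite (sum1_extend _ _ B (B + j).+1); [|lia|]; last first.
    move=> k Bk; rewrite big_nat big1 // => l l1; rewrite PB ?mul0r //; lia.
  rewrite sum1_rev; apply: eq_big_nat => x /andP[_ xB].
  rewrite (sum1_extend _ _ B (B + j').+1); [|lia|]; last first.
    move=> l Bl; rewrite PB ?mul0r //; lia.
  rewrite sum1_rev; apply: eq_big_nat => y /andP[_ yB].
  rewrite /Q; congr (P _ * _); first lia.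
  rewrite /A2 /lower; apply: eq_JT => // i; rewrite /upd /std.
  rewrite [j' == j]eq_sym (negPf nj).
  by case: eqP => [_|_]; [lia|case: eqP => // _; lia].
(* The square x, y < B + j drops out by antisymmetry, leaving j <= v < j'. *)
under eq_bigr do rewrite (big_cat_nat _ _ (n := (B + j)%N)) ?leq_add2l ?(ltnW ltj) //=.
rewrite big_split /= alternating_sum0 // add0r.
rewrite -sumrN (sum1_extend _ _ B (B + j').-1.+1); [|lia|]; last first.
  move=> r Br; rewrite PB ?mul0r ?oppr0 //.
(* On the right, the terms with x >= B + j make column j' a copy of column x - B; afterwards both
   sides run over x < B + j. *)
rewrite sum1_rev [RHS](big_cat_nat _ _ (n := (B + j)%N)) //=; last lia.
rewrite [X in _ + X]big_nat [X in _ = _ + X]big1 ?addr0; last first.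
  move=> x xB.
  have lt : (x - B < L)%N by move: (ltn_ord j'); lia.
  have nx : Ordinal lt != j' by rewrite -val_eqE /=; lia.
  rewrite (JT_eqcol _ _ _ _ nx) ?mulr0 ?oppr0 //.
  rewrite /lower /upd (negPf nx) eqxx /std /=; lia.
apply: eq_big_nat => x xB.
rewrite big_ltn ?ltn_add2l // big_nat big1 ?addr0; last first.
  move=> y yB.
  have lt : (y - B < L)%N by move: (ltn_ord j'); lia.
  have nx : Ordinal lt != j' by rewrite -val_eqE /=; lia.
  have ny : Ordinal lt != j by rewrite -val_eqE /=; lia.
  rewrite /Q /A2 (JT_eqcol _ _ _ _ nx) ?mulr0 //.
  rewrite /upd (negPf nx) (negPf ny) eqxx /std /=; lia.
(* Only v = j is left: after the swap, column j has its own value again and column j' holds u. *)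
rewrite /Q /A2 JT_upd2_swap // mulrN; congr (- (P _ * _)); first lia.
apply: eq_JT => // i; rewrite /lower /upd /std.
by case: eqP => // _; [lia|case: eqP => // ->; lia].
Qed.

Lemma lower_lower c j k l : lower (lower c j k) j l =1 lower c j (k + l).
Proof. by move=> x; rewrite /lower /upd eqxx; case: eqP => // _; lia. Qed.

Lemma lower_comm b c j j' k l :
  JT b (lower (lower c j k) j' l) = JT b (lower (lower c j' l) j k).
Proof.
case: (eqVneq j j') => [->|nj].
  by rewrite !(eq_JT _ _ _ _ (frefl b) (lower_lower _ _ _ _)) addnC.
apply: eq_JT => // x; rewrite /lower /upd [j' == j]eq_sym (negPf nj).
by case: (eqVneq x j) nj => [->|_] /= nj //; rewrite (negPf nj).
Qed.

(** With M = b_i + j - 1, the coefficient of a cofactor is sum_r r P_r H(M - r) from the terms j =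
    j', -2 j M H(M) from the terms j <> j', and sum_r (M - r) P_r H(M - r) from the second double
    sum. The total is M (M - 2j) H(M) = ((b_i - 1)^2 - j^2) H(M), and [lower_std_weighted] removes
    j^2. *)
Lemma content_sq_sum b :
  \sum_(1 <= k < B) \sum_(1 <= l < B)
     P (k + l - 1) * \sum_j \sum_j' JT b (lower (lower std j k) j' l)
  + \sum_(1 <= k < B) \sum_(1 <= l < B)
     P k * P l * \sum_j JT b (lower std j (k + l + 1))
  = \sum_i ((b i - 1) ^+ 2)%:~R * JT (lower b i 1) std.
Proof.
pose O j j' := \sum_(1 <= k < B) \sum_(1 <= l < B)
     P (k + l - 1)%N * JT b (lower (lower std j k) j' l).
pose V j := \sum_(1 <= r < B) P r * JT b (lower std j r.+1).
pose M i j : int := b i + std j - 1.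
pose cof := cofactor (JTmx b std).
have OC j j' : O j j' = O j' j.
  rewrite /O exchange_big; apply: eq_bigr => k _; apply: eq_bigr => l _.
  by rewrite lower_comm addnC.
have -> : \sum_(1 <= k < B) \sum_(1 <= l < B)
     P (k + l - 1)%N * \sum_j \sum_j' JT b (lower (lower std j k) j' l)
   = \sum_j \sum_j' O j j'.
  under eq_bigr do under eq_bigr do rewrite mulr_sumr.
  under eq_bigr do rewrite exchange_big.
  rewrite exchange_big; apply: eq_bigr => j _ /=.
  under eq_bigr do under eq_bigr do rewrite mulr_sumr.
  under eq_bigr do rewrite exchange_big.
  by rewrite exchange_big.
(* Each unordered pair occurs twice and gives minus the [V] of its larger index; j is the larger
   index of j pairs. *)
have -> : \sum_j \sum_j' O j j' = \sum_j O j j - \sum_(j < L) j.*2%:R * V j.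
  have -> : \sum_(j < L) j.*2%:R * V j
      = \sum_(j < L) (\sum_(j' < L | (j < j')%N) V j' + \sum_(j' < L | (j' < j)%N) V j).
    rewrite big_split /= (exchange_big_dep predT) //= -big_split; apply: eq_bigr => j _.
    by rewrite /= sum_ord_gt -addnn natrD mulrDl !mulr_natl.
  rewrite -sumrB; apply: eq_bigr => j _ /=.
  rewrite (bigD1 j) //= opprD; congr (_ + _).
  rewrite (bigID (fun j' : 'I_L => j < j')%N) /= -!sumrN; congr (_ + _).
    apply: eq_big => j'; last by case/andP=> _ lt; exact: offdiag_sum.
    by rewrite -val_eqE /=; lia.
  apply: eq_big => j'; first by rewrite -val_eqE /=; lia.
  move=> h; have lt : (j' < j)%N by move: h; rewrite -val_eqE /=; lia.
  by rewrite OC sumrN; exact: offdiag_sum.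
have -> : \sum_j O j j
    = \sum_i \sum_j (\sum_(1 <= r < B) (P r * H (M i j - r%:Z)) *+ r) * cof i j.
  have -> : \sum_j O j j
      = \sum_(1 <= r < B) \sum_j (P r *+ r) * JT b (lower std j r.+1).
    rewrite [RHS]exchange_big; apply: eq_bigr => j _ /=.
    under [RHS]eq_bigr do rewrite mulrnAl.
    (* Lowering one column by k and then by l lowers it by r + 1 with r = k + l - 1. *)
    rewrite -(sum_hankel _ (fun r => P r * JT b (lower std j r.+1))); last first.
      by move=> r Br; rewrite PB ?mul0r.
    apply: eq_big_nat => k k1; apply: eq_big_nat => l l1.
    congr (_ * _); rewrite (eq_JT _ _ _ _ (frefl b) (lower_lower _ _ _ _)).
    by congr (JT b (lower _ _ _)); lia.
  under eq_bigr do rewrite sum_lower_col.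
  rewrite exchange_big; apply: eq_bigr => i _ /=.
  rewrite exchange_big; apply: eq_bigr => j _ /=.
  rewrite mulr_suml; apply: eq_bigr => r _.
  by congr (_ * _); rewrite mulrnAl; congr (_ * H _ *+ _); rewrite /M; lia.
have -> : \sum_(1 <= k < B) \sum_(1 <= l < B)
     P k * P l * \sum_j JT b (lower std j (k + l + 1))
   = \sum_i \sum_j (\sum_(1 <= r < B) P r * ((M i j - r%:Z)%:~R * H (M i j - r%:Z)))
        * cof i j.
  have E (F : 'I_L -> A) : \sum_i F i = \sum_i 1 * F i.
    by apply: eq_bigr => i _; rewrite mul1r.
  under eq_bigr do under eq_bigr do rewrite E sum_lower_col mulr_sumr.
  under eq_bigr do rewrite exchange_big.
  rewrite exchange_big; apply: eq_bigr => i _ /=.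
  under eq_bigr do under eq_bigr do rewrite mulr_sumr.
  under eq_bigr do rewrite exchange_big.
  rewrite exchange_big; apply: eq_bigr => j _ /=.
  rewrite mulr_suml; apply: eq_bigr => k _; rewrite newton mulr_sumr mulr_suml.
  apply: eq_bigr => l _.
  have -> : b i + std j - (k + l + 1)%N%:Z = M i j - k%:Z - l%:Z by rewrite /M; lia.
  by rewrite mul1r !mulrA.
have -> : \sum_(j < L) j.*2%:R * V j
    = \sum_i \sum_(j < L) (j.*2%:R * (M i j)%:~R * H (M i j)) * cof i j.
  rewrite -(newton_lowerS b std (fun j : 'I_L => j.*2%:R)).
  under eq_bigr do rewrite mulr_sumr.
  under [RHS]eq_bigr do rewrite mulr_sumr.
  rewrite exchange_big; apply: eq_bigr => r _; apply: eq_bigr => j _ /=; ring.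
rewrite sum_lower_row -[RHS]subr0.
rewrite -[X in _ = _ - X](lower_std_weighted b (fun k => (k ^ 2)%N%:R)) //.
rewrite sum_lower_col.
rewrite -!sumrB -!big_split; apply: eq_bigr => i _.
rewrite -!sumrB -!big_split; apply: eq_bigr => j _ /=.
rewrite -mulrBl -mulrDl -mulrBl; congr (_ * _).
have -> : \sum_(1 <= r < B) P r * ((M i j - r%:Z)%:~R * H (M i j - r%:Z))
   = (M i j)%:~R ^+ 2 * H (M i j) - \sum_(1 <= r < B) (P r * H (M i j - r%:Z)) *+ r.
  rewrite expr2 -mulrA newton mulr_sumr -sumrB; apply: eq_bigr => r _.
  rewrite -mulr_natl intrD intrN; ring.
rewrite /M /std -mul2n natrM natrX !(intrD, intrN, rmorphXn) /=; ring.
Qed.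

End JacobiTrudi.

(** * Complete functions and derivations *)

Section Newton.
Variables (R : numFieldType) (A : algType R).
Implicit Types p q : nat -> A.

(** The recursion of [hseq] over an arbitrary sequence [p], so that it applies both to the power
    sums and to their images in the quotient. *)
Fixpoint newton_seq p (k : nat) : seq A :=
  if k is k'.+1 then
    let s := newton_seq p k' in
    rcons s ((k'.+1%:R)^-1 *: \sum_(1 <= r < k'.+2) p r * nth 0 s (k'.+1 - r))
  else [:: 1].

Definition complete p (k : nat) : A := nth 0 (newton_seq p k) k.

Definition completeZ p (N : int) : A := if N is Posz k then complete p k else 0.

Lemma size_newton_seq p k : size (newton_seq p k) = k.+1.
Proof. by elim: k => //= k IH; rewrite size_rcons IH. Qed.

Lemma nth_newton_seq p j k : (j <= k)%N -> nth 0 (newton_seq p k) j = complete p j.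
Proof.
elim: k => [|k IH]; first by case: j.
rewrite leq_eqVlt => /predU1P[-> //|lt].
by rewrite /= nth_rcons size_newton_seq lt IH.
Qed.

Lemma completeS p k :
  k.+1%:R *: complete p k.+1 = \sum_(1 <= r < k.+2) p r * complete p (k.+1 - r).
Proof.
rewrite /complete /= nth_rcons size_newton_seq ltnn eqxx scalerA divff ?scale1r.
  by apply: eq_big_nat => r r1; rewrite nth_newton_seq //; lia.
by rewrite pnatr_eq0.
Qed.

Lemma completeZ_neg p N : N < 0 -> completeZ p N = 0.
Proof. by case: N. Qed.

(** Since [completeZ] is zero at negative indices, every bound beyond N gives the full sum. *)
Lemma completeZ_newton_lt p B (N : int) : N < B%:Z ->
  N%:~R * completeZ p N = \sum_(1 <= r < B) p r * completeZ p (N - r%:Z).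
Proof.
case: N => [[|k]|k] NB.
- rewrite mul0r big_nat big1 // => r r1.
  by rewrite completeZ_neg ?mulr0 //; lia.
- rewrite /= mulr_natl -scaler_nat completeS.
  rewrite -[RHS](sum1_extend _ _ k.+2) //.
  + apply: eq_big_nat => r rk; congr (_ * _).
    by have -> : k.+1%:Z - r%:Z = (k.+1 - r)%N%:Z by lia.
  + by move=> r kr; rewrite completeZ_neg ?mulr0 //; lia.
- rewrite mulr0 big_nat big1 // => r r1.
  by rewrite completeZ_neg ?mulr0 //; lia.
Qed.

Lemma completeZ_newton p B : (forall r, (B <= r)%N -> p r = 0) ->
  forall N : int,
  N%:~R * completeZ p N = \sum_(1 <= r < B) p r * completeZ p (N - r%:Z).
Proof.
move=> pB N; rewrite (completeZ_newton_lt _ (B + `|N|.+1)); last lia.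
rewrite [RHS](sum1_extend _ _ B (B + `|N|.+1)) //; first exact: leq_addr.
by move=> r /pB ->; rewrite mul0r.
Qed.

Lemma complete_lrmorph (f : {lrmorphism A -> A}) p q k :
  (forall r, (0 < r <= k)%N -> f (p r) = q r) -> f (complete p k) = complete q k.
Proof.
elim/ltn_ind: k => -[|k] IH e; first exact: rmorph1.
have kU : k.+1%:R != 0 :> R by rewrite pnatr_eq0.
apply: (scalerI kU); rewrite -linearZ_LR !completeS raddf_sum.
apply: eq_big_nat => r rk /=; rewrite rmorphM.
congr (_ * _); first by apply: e; lia.
apply: IH => [|r' r'k]; [lia | apply: e; lia].
Qed.

End Newton.

Section Derivation.
Variables (A : comNzRingType) (d : {additive A -> A}).
Hypothesis dM : forall x y, d (x * y) = d x * y + x * d y.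

Lemma derivation_prod (I : eqType) (r : seq I) (F : I -> A) : uniq r ->
  d (\prod_(i <- r) F i)
  = \sum_(i <- r) d (F i) * \prod_(j <- r | j != i) F j.
Proof.
have d1 : d 1 = 0.
  by apply: (addrI (d 1)); rewrite addr0 -[in RHS](mulr1 1) dM mulr1 mul1r.
elim: r => [|a r IH] /=; first by rewrite !big_nil.
case/andP=> ar /IH {}IH; rewrite !big_cons eqxx dM IH; congr (d _ * _ + _).
  rewrite big_seq [RHS]big_seq_cond; apply: eq_bigl => i.
  by case: eqP => [->|]; rewrite ?(negPf ar) ?andbT.
rewrite mulr_sumr [LHS]big_seq [RHS]big_seq; apply: eq_bigr => i ir.
rewrite big_cons; case: eqP ar ir => [->|_ _ _]; first by move=> /negPf ->.
by rewrite mulrCA.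
Qed.

(** In the Leibniz expansion of the determinant each product has one factor per row, so the
    derivation lowers one row at a time; [lower_row_col] passes to columns. *)
Lemma derivation_JT (H : int -> A) L (x : A) (k : nat) (b c : 'I_L -> int) :
  (forall N, x * d (H N) = H (N - k%:Z)) ->
  x * d (JT A H L b c) = \sum_j JT A H L b (lower L c j k).
Proof.
move=> dH; rewrite lower_row_col /JT /determinant raddf_sum mulr_sumr.
rewrite [RHS]exchange_big; apply: eq_bigr => s _ /=.
have dsign y : d ((-1) ^+ s * y) = (-1) ^+ s * d y.
  by rewrite !mulr_sign; case: ifP => // _; rewrite raddfN.
rewrite dsign derivation_prod ?index_enum_uniq // mulrCA mulr_sumr.
rewrite -[RHS]mulr_sumr; congr (_ * _); apply: eq_bigr => i _.
rewrite [RHS](bigD1 i) //= !mxE /lower /upd eqxx mulrA dH addrAC.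
congr (_ * _); apply: eq_bigr => j /negPf ji; by rewrite !mxE ji.
Qed.

End Derivation.

Section DerivationComplete.
Variables (R : numFieldType) (A : comAlgType R) (d : {additive A -> A}).
Hypothesis dM : forall x y, d (x * y) = d x * y + x * d y.

(** Applying m d to Newton's identity for k + 1 gives, by induction, sum_r p_r h_(k+1-r-m) + m
    h_(k+1-m). Newton's identity again turns the sum into (k+1-m) h_(k+1-m). *)
Lemma derivation_completeZ (p : nat -> A) (m : nat) : (0 < m)%N ->
  (forall r, (0 < r)%N -> d (p r) = (r == m)%:R) ->
  forall N, m%:R * d (completeZ R A p N) = completeZ R A p (N - m%:Z).
Proof.
move=> m0 dp [k|k] /=; last first.
  by rewrite raddf0 mulr0 completeZ_neg //; lia.
elim/ltn_ind: k => -[|k] IH.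
  have d1 : d 1 = 0.
    by apply: (addrI (d 1)); rewrite addr0 -[in RHS](mulr1 1) dM mulr1 mul1r.
  by rewrite d1 mulr0 completeZ_neg //; lia.
have kU : k.+1%:R != 0 :> R by rewrite pnatr_eq0.
apply: (scalerI kU); rewrite !scaler_nat -[in LHS]mulrnAr -raddfMn.
rewrite -[complete _ _ _ _ *+ _]scaler_nat completeS.
have -> : completeZ R A p (k.+1%:Z - m%:Z) *+ k.+1
    = (k.+1%:Z - m%:Z)%:~R * completeZ R A p (k.+1%:Z - m%:Z)
      + m%:R * completeZ R A p (k.+1%:Z - m%:Z).
  by rewrite -mulrDl -[m%:R]/(m%:Z%:~R) -intrD subrK -mulr_natl.
rewrite (completeZ_newton_lt _ _ _ k.+2); last lia.
have -> : m%:R * completeZ R A p (k.+1%:Z - m%:Z)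
   = \sum_(1 <= r < k.+2) (r == m)%:R * (m%:R * completeZ R A p (k.+1%:Z - r%:Z)).
  case: (ltnP m k.+2) => mk.
    rewrite (bigD1_seq m) ?mem_index_iota ?m0 ?iota_uniq //= eqxx mul1r.
    by rewrite big1 ?addr0 // => r /negPf ->; rewrite mul0r.
  rewrite completeZ_neg ?mulr0; last lia.
  rewrite big_nat big1 // => r rk; rewrite (_ : (r == m) = false) ?mul0r //; lia.
rewrite -big_split raddf_sum mulr_sumr; apply: eq_big_nat => r rk /=.
have e : k.+1%:Z - r%:Z = (k.+1 - r)%N%:Z by lia.
rewrite dM dp ?e //=; last lia.
rewrite mulrDr addrC [m%:R * (p r * _)]mulrCA IH; last lia.
rewrite mulrCA; congr (_ + _ * _).
by congr completeZ; lia.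
Qed.

End DerivationComplete.

(** * The operator on Jacobi-Trudi determinants *)

Section Operator.
Variables (R : rcfType) (n : nat).

(* The image [p_r^o = q_(r-1)] of the power sum [p_r] (for [r >= 1]). *)
Definition psum0 (r : nat) : {mpoly R[n]} := qv R n r.-1.

Definition hom0 : int -> {mpoly R[n]} := completeZ R {mpoly R[n]} psum0.

Lemma dqE (i : 'I_n) p : dq R n i.+1 p = p^`M(i).
Proof. by rewrite /dq valK. Qed.

Lemma dq_big k p : (n < k)%N -> dq R n k p = 0.
Proof. by case: k => //= k nk; rewrite insubN // -leqNgt. Qed.

(** The image of p_(n+1) is q_n, the last variable, so sums over power sums run up to n + 1. *)
Lemma psum0_big r : (n.+2 <= r)%N -> psum0 r = 0.
Proof.
by case: r => [|[|r]] // nr; rewrite /psum0 /qv /= insubN // -leqNgt.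
Qed.

(** The variable with index [i] is q_(i+1), the image of p_(i+2). *)
Lemma mderiv_psum0 (i : 'I_n) r : (0 < r)%N ->
  (psum0 r)^`M(i) = (r == i.+2)%:R.
Proof.
case: r => [|[|r]] // _; rewrite /psum0 /qv /=.
  by rewrite -mpolyC1 mderivC.
case: insubP => [j _ <-|/negPf rn]; last first.
  rewrite mderiv0 (_ : (r.+2 == i.+2) = false) //.
  by apply/negP => /eqP[e]; move: rn; rewrite e ltn_ord.
rewrite mderivX mnm1E !eqSS -val_eqE /=.
case: eqP => [e|_]; last by rewrite scale0r.
by rewrite (val_inj e) -{1}[U_(i)%MM]add0m addmK mpolyX0 scale1r.
Qed.

Lemma mderiv_hom0 (i : 'I_n) N : i.+2%:R * (hom0 N)^`M(i) = hom0 (N - i.+2%:Z).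
Proof.
apply: (derivation_completeZ _ _ (mderiv i)) => //.
- by move=> x y; rewrite /= mderivM.
- exact: mderiv_psum0.
Qed.

Variables (L : nat) (b : 'I_L -> int).

Local Notation JT := (JT {mpoly R[n]} hom0 L).
Local Notation lower := (lower L).
Local Notation std := (std L).

Lemma dq_JT k c : (1 <= k <= n)%N ->
  k.+1%:R * dq R n k (JT b c) = \sum_j JT b (lower c j k.+1).
Proof.
case: k => // k kn; have lt : (k < n)%N by lia.
rewrite -[k.+1]/((Ordinal lt).+1) dqE.
apply: (derivation_JT _ (mderiv (Ordinal lt))).
- by move=> x y; rewrite /= mderivM.
- exact: mderiv_hom0.
Qed.

Hypothesis b_le : forall i j : 'I_L, b i + std j <= n%:Z.

(** For k > n the derivative is 0, and so is the right side: by [b_le] all entries of the lowered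
    column have negative index. *)
Lemma dq_JT_std k : (0 < k)%N ->
  k.+1%:R * dq R n k (JT b std) = \sum_j JT b (lower std j k.+1).
Proof.
move=> k0; case: (leqP k n) => kn; first by apply: dq_JT; rewrite k0.
rewrite dq_big // mulr0 big1 // => j _; rewrite JT_upd big1 // => i _.
by rewrite /hom0 completeZ_neg ?mul0r //; move: (b_le i j); lia.
Qed.

Lemma Dop_JT (a a' : R) :
  let m : int := \sum_i b i + \sum_j std j in
  Dop R n a a' (JT b std)
  = - (m%:~R * (m%:~R - 1 + a)) *: JT b std
    + \sum_i (a + a' * (b i - 1)%:~R + (b i - 1)%:~R ^+ 2) *: JT (lower b i 1) std.
Proof.
move=> m; pose s := JT b std.
(* [D1 k] and [D2 k l] stand for D_k s and D_l D_k s, also when k or l is 1, where there is no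
   variable to differentiate by. *)
pose D1 k := \sum_j JT b (lower std j k).
pose D2 k l := \sum_j \sum_j' JT b (lower (lower std j k) j' l).
have newton := completeZ_newton R {mpoly R[n]} psum0 n.+2 psum0_big.
have dqs k : (0 < k)%N -> k.+1%:R * dq R n k s = D1 k.+1 by exact: dq_JT_std.
have dqdqs k l : (0 < k <= n)%N -> (0 < l <= n)%N ->
    (l.+1%:R * k.+1%:R) * dq R n l (dq R n k s) = D2 k.+1 l.+1.
  move=> kn ln; rewrite -mulrA.
  have -> : k.+1%:R * dq R n l (dq R n k s) = dq R n l (k.+1%:R * dq R n k s).
    rewrite !mulr_natl; case: l ln => // l ln.
    have lt : (l < n)%N by lia.
    by rewrite -[l.+1]/((Ordinal lt).+1) !dqE mderivMn.
  rewrite dqs; last by case/andP: kn.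
  rewrite /D1 /D2; case: l ln => // l ln; have lt : (l < n)%N by lia.
  rewrite -[l.+1]/((Ordinal lt).+1) dqE raddf_sum mulr_sumr.
  apply: eq_bigr => j _; have := dq_JT l.+1 (lower std j k.+1) ln.
  by rewrite (dqE (Ordinal lt)).
have E1 : \sum_(1 <= k < n.+2) psum0 k * D1 k = m%:~R * s.
  exact: (euler _ _ _ _ _ newton).
(* Euler's identity for determinants with one column lowered by k, whose degree is m - k. *)
have E2 k : \sum_(1 <= l < n.+2) psum0 l * D2 k l = (m - k%:Z)%:~R * D1 k.
  under eq_bigr do rewrite mulr_sumr.
  rewrite exchange_big mulr_sumr; apply: eq_bigr => j _ /=.
  rewrite (euler _ _ _ _ _ newton); congr (_%:~R * _).
  rewrite /m -addrA; congr (_ + _).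
  rewrite (bigD1 j) //= [in RHS](bigD1 j) //= {1}/lower /upd eqxx.
  rewrite [LHS]addrAC; congr (_ + _ - _).
  by apply: eq_bigr => j' /negPf nj; rewrite /lower /upd nj.
have F1 : \sum_(1 <= k < n.+2) psum0 k * D1 k.+1
    = \sum_i (b i - 1)%:~R * JT (lower b i 1) std.
  exact: (content_sum _ _ _ _ _ newton).
have G1 := content_sq_sum _ _ _ _ _ psum0_big newton b.
have p1 : psum0 1 = 1 by [].
have dq2E : \sum_(1 <= i < n.+1) \sum_(1 <= j < n.+1)
       ((i.+1 * j.+1)%:R *: ((qv R n (i + j) - qv R n i * qv R n j)
          * dq R n i (dq R n j s)))
   = \sum_(1 <= k < n.+2) \sum_(1 <= l < n.+2)
       (psum0 (k + l - 1) - psum0 k * psum0 l) * D2 k l.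
  rewrite [RHS]big_ltn // [X in _ = X + _]big_nat.
  rewrite [X in _ = X + _]big1 ?add0r; last first.
    move=> l l1; rewrite p1 mul1r (_ : (1 + l - 1)%N = l) ?subrr ?mul0r //; lia.
  rewrite exchange_big [RHS]big_add1; apply: eq_big_nat => k kn /=.
  rewrite [RHS]big_ltn // p1 mulr1 addnK subrr mul0r add0r.
  rewrite [RHS]big_add1; apply: eq_big_nat => l ln /=.
  rewrite -dqdqs // scaler_nat -[LHS]mulr_natl natrM [in RHS]mulrA.
  rewrite (_ : (k.+1 + l.+1 - 1) = (l + k).+1)%N; last lia.
  rewrite /psum0 /=; ring.
have sE (w : nat -> {mpoly R[n]}) : \sum_(1 <= i < n.+1) i.+1%:R *: (w i * dq R n i s)
    = \sum_(1 <= k < n.+1) w k * D1 k.+1.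
  apply: eq_big_nat => k kn; rewrite -dqs; last lia.
  by rewrite scaler_nat -[LHS]mulr_natl mulrCA.
(* The Euler sum has the additional term k = 1, equal to [D1 1]; it produces the coefficient [a] of
   the box removals. *)
have T2 : \sum_(1 <= i < n.+1) i.+1%:R *: (qv R n i * dq R n i s) = m%:~R * s - D1 1.
  rewrite sE -E1 [in RHS]big_ltn // p1 mul1r addrC addKr.
  by rewrite [RHS]big_add1.
(* The term k = n + 1 of [F1] vanishes, as there is no variable q_(n+1). *)
have T3 : \sum_(1 <= i < n.+1) i.+1%:R *: (qv R n i.-1 * dq R n i s)
   = \sum_i (b i - 1)%:~R * JT (lower b i 1) std.
  rewrite sE -F1 [in RHS]big_nat_recr //= -dqs // dq_big // !mulr0 addr0.
  by [].
have T4 : \sum_(0 <= i < n.+1) \sum_(0 <= j < n.+1)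
       ((i + j + 3)%:R *: (qv R n i * qv R n j * dq R n (i + j + 2) s))
   = \sum_(1 <= k < n.+2) \sum_(1 <= l < n.+2) psum0 k * psum0 l * D1 (k + l + 1).
  rewrite [RHS]big_add1; apply: eq_big_nat => k kn /=.
  rewrite [RHS]big_add1; apply: eq_big_nat => l ln /=.
  have -> : D1 (k.+1 + l.+1 + 1)%N = D1 (k + l + 2).+1 by congr D1; lia.
  rewrite -dqs; last lia.
  rewrite (_ : (k + l + 3) = (k + l + 2).+1)%N; last lia.
  by rewrite scaler_nat -[LHS]mulr_natl mulrCA.
have T5 : \sum_(1 <= i < n.+1) ((i.+1 * i)%:R *: (qv R n i * dq R n i s))
   = \sum_(1 <= k < n.+2) (k%:Z - 1)%:~R * (psum0 k * D1 k).
  rewrite [RHS]big_ltn // subrr mul0r add0r big_add1; apply: eq_big_nat => k kn /=.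
  rewrite -dqs; last lia.
  rewrite scaler_nat -[LHS]mulr_natl natrM (_ : k.+1%:Z - 1 = k%:Z) /psum0; last lia.
  rewrite /= -[k%:~R]/(k%:R); ring.
have D1E : D1 1 = \sum_i JT (lower b i 1) std by rewrite /D1 lower_row_col.
rewrite /Dop dq2E T2 T3 T4 T5.
have -> : \sum_(1 <= k < n.+2) \sum_(1 <= l < n.+2)
      (psum0 (k + l - 1) - psum0 k * psum0 l) * D2 k l
   = \sum_(1 <= k < n.+2) \sum_(1 <= l < n.+2) psum0 (k + l - 1) * D2 k l
     - \sum_(1 <= k < n.+2) (m - k%:Z)%:~R * (psum0 k * D1 k).
  rewrite -sumrB; apply: eq_bigr => k _.
  rewrite mulrCA -E2 mulr_sumr -sumrB; apply: eq_bigr => l _.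
  by rewrite mulrBl mulrA.
have G2 : \sum_(1 <= k < n.+2) \sum_(1 <= l < n.+2) psum0 (k + l - 1) * D2 k l
   = \sum_i ((b i - 1) ^+ 2)%:~R * JT (lower b i 1) std
    - \sum_(1 <= k < n.+2) \sum_(1 <= l < n.+2) psum0 k * psum0 l * D1 (k + l + 1).
  by rewrite -G1 addrK.
(* Writing m - k = (m - 1) - (k - 1) isolates the part that cancels [T5]. *)
have E3 : \sum_(1 <= k < n.+2) (m - k%:Z)%:~R * (psum0 k * D1 k)
   = (m - 1)%:~R * (m%:~R * s)
     - \sum_(1 <= k < n.+2) (k%:Z - 1)%:~R * (psum0 k * D1 k).
  rewrite -E1 mulr_sumr -sumrB; apply: eq_bigr => k _.
  rewrite !(intrD, intrN); ring.
have -> : \sum_i (a + a' * (b i - 1)%:~R + (b i - 1)%:~R ^+ 2) *: JT (lower b i 1) std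
   = a *: D1 1 + a' *: (\sum_i (b i - 1)%:~R * JT (lower b i 1) std)
     + \sum_i ((b i - 1) ^+ 2)%:~R * JT (lower b i 1) std.
  rewrite D1E !scaler_sumr -!big_split; apply: eq_bigr => i _ /=.
  by rewrite !scalerDl -scalerA !mulrzl !scaler_int -!rmorphXn /= !scaler_int.
have -> : - (m%:~R * (m%:~R - 1 + a)) *: s
   = - ((m - 1)%:~R * (m%:~R * s)) - a *: (m%:~R * s).
  have E (N : int) (x : {mpoly R[n]}) : N%:~R * x = N%:~R *: x.
    by rewrite mulrzl scaler_int.
  rewrite !E !scalerA -scaleNr -scalerBl; congr (_ *: _).
  rewrite intrD intrN; ring.
rewrite G2 E3 scalerBr.
move: (\sum_(1 <= k < n.+2) \sum_(1 <= l < n.+2) _) => X.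
move: (\sum_(1 <= k < n.+2) _) => Y.
ring.
Qed.

End Operator.

(** * Partitions *)

Section Schur.
Variables (R : rcfType) (n : nat).

Lemma hseqE k : hseq R n k = newton_seq R {mpoly R[n]} (psum R n) k.
Proof. by elim: k => //= k ->. Qed.

(** For 1 <= r <= n the image of p_r is [psum0 r]. This fails at r = n + 1, where [psum] is already
    0 while [psum0] is still q_n; hence the bound on N. *)
Lemma circ_hZ N : N <= n%:Z -> circ R n (hZ R n N) = hom0 R n N.
Proof.
case: N => [k|k] kn /=; last by rewrite /circ raddf0.
rewrite /hP hseqE; apply: (complete_lrmorph _ _ (comp_mpoly _)) => r rk.
case: r rk => // r rk; have lt : (r < n)%N by lia.
rewrite /psum /var1 (insubT (fun i => i < n)%N lt) /= comp_mpolyXU.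
by rewrite -tnth_nth tnth_mktuple.
Qed.

Definition JTn (L : nat) (g : nat -> int) : {mpoly R[n]} :=
  JT {mpoly R[n]} (hom0 R n) L (fun i => g i) (std L).

(** Rows are numbered from 0, so the last box of row i has content [shift_shape mu i - 1]. *)
Definition shift_shape (mu : seq nat) (i : nat) : int := (nth 0%N mu i)%:Z - i%:Z.

Lemma eq_JTn L g g' : (forall i, (i < L)%N -> g i = g' i) -> JTn L g = JTn L g'.
Proof. by move=> e; apply: eq_JT => // i; apply: e. Qed.

Lemma schur0E mu :
  (forall i j, (i < size mu)%N -> (j < size mu)%N -> (nth 0 mu i + j <= n)%N) ->
  schur0 R n mu = JTn (size mu) (shift_shape mu).
Proof.
move=> bound; rewrite /schur0 /schurP /circ -det_map_mx; congr (\det _).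
apply/matrixP => i j; rewrite !mxE; apply: circ_hZ.
by move: (bound i j (ltn_ord i) (ltn_ord j)); lia.
Qed.

(** The last row belongs to an empty part: its entries h_(j-L) are 0 except for the final 1. *)
Lemma JTn_last L g : g L = - L%:Z -> JTn L.+1 g = JTn L g.
Proof.
move=> gL; rewrite /JTn /JT (expand_det_row _ ord_max) (bigD1 ord_max) //=.
rewrite big1 ?addr0; last first.
  move=> j nj; rewrite mxE /= gL /std /hom0 completeZ_neg ?mul0r //.
  by move: nj (ltn_ord j); rewrite -val_eqE /=; lia.
rewrite mxE /= gL /std /= addNr mul1r /cofactor /= addnn -signr_odd odd_double mul1r.
congr (\det _); apply/matrixP => i j; rewrite !mxE /= /bump.
by rewrite !(leqNgt L) !ltn_ord.
Qed.

Lemma lower_JTn L (g : nat -> int) (r : 'I_L) :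
  JT {mpoly R[n]} (hom0 R n) L (lower L (fun i : 'I_L => g i) r 1) (std L)
  = JTn L (fun i => g i - (i == r :> nat)%:Z).
Proof.
apply: eq_JT => // i; rewrite /lower /upd -val_eqE.
by case: eqP => [->|_]; rewrite ?subr0.
Qed.

Section Partition.
Variable mu : seq nat.
Hypothesis mu_part : is_partition mu.

Lemma nth_gt0 i : (i < size mu)%N -> (0 < nth 0 mu i)%N.
Proof.
case/andP: mu_part => _ mu0 lt; rewrite lt0n; apply: contra mu0 => /eqP <-.
exact: mem_nth.
Qed.

Lemma nth_noninc i : (nth 0 mu i.+1 <= nth 0 mu i)%N.
Proof.
case/andP: mu_part => ms _; case: (ltnP i.+1 (size mu)) => lt.
  by move/(sortedP 0%N): ms => /(_ i lt).
by rewrite nth_default.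
Qed.

Lemma size_le_sumn : (size mu <= sumn mu)%N.
Proof.
case/andP: mu_part => _; elim: (mu) => //= x s IH.
by rewrite in_cons negb_or => /andP[x0 /IH]; lia.
Qed.

Lemma nth_le_sumn i : (nth 0 mu i <= sumn mu)%N.
Proof.
elim: (mu) i => [|x s IH] [|i] //=; first exact: leq_addr.
by apply: leq_trans (IH i) _; exact: leq_addl.
Qed.

(** Parts r and r + 1 are equal, so lowering row r makes it coincide with the next row of the
    matrix. *)
Lemma JT_lower_noncorner r : (r < size mu)%N -> ~~ corner mu r ->
  JTn (size mu) (fun i => shift_shape mu i - (i == r)%:Z) = 0.
Proof.
rewrite /corner -leqNgt => rm nc;
have e := anti_leq (introT andP (conj nc (nth_noninc r))).
have lt : (r.+1 < size mu)%N.
  by rewrite ltnNge; apply/negP => h; move: (nth_gt0 r rm); rewrite e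
    nth_default.
have nr : Ordinal rm != Ordinal lt by rewrite -val_eqE /=; lia.
rewrite /JTn JT_sym (JT_eqcol _ _ _ _ _ _ _ nr) // /shift_shape /= eqxx -e.
by rewrite (_ : (r.+1 == r) = false); lia.
Qed.

Lemma schur0_remove_box r : (r < size mu)%N ->
  (2 * sumn mu <= n)%N -> corner mu r ->
  schur0 R n (remove_box mu r)
  = JTn (size mu) (fun i => shift_shape mu i - (i == r)%:Z).
Proof.
move=> rm hn; rewrite /corner => cr.
have sz := size_le_sumn.
have r0 := nth_gt0 r rm.
pose nu := set_nth 0%N mu r (nth 0%N mu r).-1.
have szn : size nu = size mu by rewrite size_set_nth; apply/maxn_idPr.
have nthn i : nth 0%N nu i = (nth 0%N mu i - (i == r))%N.
  by rewrite nth_set_nth /=; case: eqP => [->|_]; rewrite ?subn1 ?subn0.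
have shapen i : shift_shape nu i = shift_shape mu i - (i == r)%:Z.
  rewrite /shift_shape nthn; case: eqP => [->|_] /=; lia.
have bnd i j : (j < size mu)%N -> (nth 0%N nu i + j <= n)%N.
  by move=> jm; rewrite nthn; move: (nth_le_sumn i); lia.
have [r1|r1] := ltnP 1%N (nth 0%N mu r).
  have -> : remove_box mu r = nu.
    apply/all_filterP/(all_nthP 0%N) => i; rewrite szn nthn => im.
    by case: eqP => [->|_]; [lia | rewrite subn0 nth_gt0].
  rewrite schur0E ?szn; first by apply: eq_JTn.
  by move=> i j _; exact: bnd.
(* A corner in a row of length 1 lies in the last row. Its removal empties that row, and [JTn_last]
   accounts for the smaller determinant. *)
have rL : size mu = r.+1.
  apply/eqP; rewrite eqn_leq rm andbT leqNgt; apply/negP => lt.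
  by move: (nth_gt0 _ lt); lia.
have rem : remove_box mu r = take r nu.
  rewrite /remove_box -/nu -{1}(cat_take_drop r nu) filter_cat.
  have szr : size nu = r.+1 by rewrite szn.
  have -> : drop r nu = [:: 0%N].
    rewrite (drop_nth 0%N) ?szr // drop_oversize ?szr // nthn eqxx.
    by congr (_ :: _); lia.
  rewrite /= cats0; apply/all_filterP/(all_nthP 0%N) => i.
  rewrite size_take szn rL ltnSn => ir; rewrite nth_take // nthn.
  by rewrite (_ : (i == r) = false) ?subn0 ?nth_gt0 //; lia.
have szr : size (take r nu) = r by rewrite size_take szn rL ltnSn.
rewrite rem rL JTn_last; last first.
  by rewrite /shift_shape eqxx; lia.
rewrite schur0E szr; last first.
  by move=> i j ir jr; rewrite nth_take // bnd // rL ltnW.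
apply: eq_JTn => i ir; rewrite -shapen /shift_shape nth_take //.
Qed.

Lemma sum_shift_shape :
  \sum_(i < size mu) shift_shape mu i + \sum_(j < size mu) std (size mu) j
  = (sumn mu)%:Z.
Proof.
rewrite -big_split /= sumnE (big_nth 0%N) big_mkord (raddf_sum Posz).
by apply: eq_bigr => i _; rewrite /= /shift_shape /std subrK.
Qed.

End Partition.
End Schur.

Lemma Re_content_mul (R : rcfType) (z z' : R[i]) (c : int) :
  complex.Re ((z + c%:~R) * (z' + c%:~R))
  = complex.Re (z * z') + complex.Re (z + z') * c%:~R + c%:~R ^+ 2.
Proof.
rewrite -(rmorph_int (real_complex R)); case: z z' => [x y] [x' y'] /=.
ring.
Qed.

(** The s°_mu span the algebra, so their images determine the operator. Since |mu| bounds both the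
    parts and their number, [hn] keeps all indices mu_i + j within n, out of reach of the
    truncation. In both series zz' and z + z' are real, so real parts lose nothing. *)
Theorem theorem6p1 (R : rcfType) (z z' : R[i])
    (hzz : principal_or_complementary R z z')
    (n : nat) (mu : seq nat) (hmu : is_partition mu)
    (hn : (2 * sumn mu <= n)%N) :
  Dop R n (complex.Re (z * z')) (complex.Re (z + z')) (schur0 R n mu)
  = (- ((sumn mu)%:R * ((sumn mu)%:R - 1 + complex.Re (z * z')))) *: schur0 R n mu
    + \sum_(r < size mu | corner mu r)
        complex.Re ((z + (box_content mu r)%:~R) * (z' + (box_content mu r)%:~R))
          *: schur0 R n (remove_box mu r).
Proof.
have bound i j : (i < size mu)%N -> (j < size mu)%N -> (nth 0 mu i + j <= n)%N.
  by move: (nth_le_sumn mu i) (size_le_sumn mu hmu); lia.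
rewrite (schur0E _ _ _ bound) Dop_JT; last first.
  move=> i j; move: (bound i j (ltn_ord i) (ltn_ord j)).
  by rewrite /shift_shape /std; lia.
rewrite sum_shift_shape; congr (_ + _).
(* The determinant formula sums over all rows; those without a corner contribute 0. *)
rewrite [RHS]big_mkcond; apply: eq_bigr => r _; rewrite lower_JTn.
case: ifPn => [cr|nc]; last by rewrite JT_lower_noncorner // scaler0.
rewrite schur0_remove_box // Re_content_mul /box_content /shift_shape.
by rewrite (_ : (nth 0%N mu r)%:Z - r%:Z - 1 = (nth 0%N mu r)%:Z - r.+1%:Z) //; lia.
Qed.
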